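(* Let $[b_0,b_1,\dotsc]$ be an infinite (negative) continued fraction with integer coefficients, and let $p^{(n)}$, $p=\liminf p^{(n)}$, the limit continued fraction $[b_0^*,b_1^*,\dotsc]$ (defined when $p=\infty$) and $q^{(n)}$ (defined when $p<\infty$) be as defined in the context. (i) Suppose that $p^{(n)}\to\infty$ as $n\to\infty$. (a) If $[b_0^*,b_1^*,\dotsc]$ has the same tail as $[2,2,\dotsc]$ or $[-2,-2,\dotsc]$, then $[b_0,b_1,\dotsc]$ converges to a rational. (b) Otherwise, $[b_0,b_1,\dotsc]$ converges to an irrational. (ii) Suppose that $p^{(n)}\not\to\infty$ as $n\to\infty$. (a) If $q^{(n)}\to\infty$, then $[b_0,b_1,\dotsc]$ converges to an extended rational. (b) If $q^{(n)}\not\to\infty$, then $[b_0,b_1,\dotsc]$ diverges.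
   Context: Let $\mathbb{R}_\infty=\mathbb{R}\cup\{\infty\}$ be the extended real line (one point $\infty$ at infinity, with its usual topology, a circle) and $\mathbb{Q}_\infty=\mathbb{Q}\cup\{\infty\}$ the set of extended rationals. A continued fraction $[b_0,b_1,\dotsc]$ is the negative continued fraction $b_0-\cfrac{1}{b_1-\cfrac{1}{b_2-\dotsb}}$ determined by an infinite sequence of integers $b_0,b_1,\dotsc$ (any integers allowed). With $s_n(z)=b_n-1/z$ (a Möbius transformation of $\mathbb{R}_\infty$, with usual conventions, so $s_n(\infty)=b_n$, $s_n(0)=\infty$) and $S_n=s_0\circ s_1\circ\dotsb\circ s_n$, the $n$th convergent is $v_n=[b_0,\dots,b_n]=S_n(\infty)\in\mathbb{Q}_\infty$, $n=0,1,\dotsc$. The continued fraction converges if the sequence $(v_n)$ converges in $\mathbb{R}_\infty$ (the limit is its value), and diverges otherwise. Two continued fractions $[b_0,b_1,\dotsc]$ and $[c_0,c_1,\dotsc]$ have the same tail if there are positive integers $r,s$ such that the sequences $b_r,b_{r+1},\dotsc$ and $c_s,c_{s+1},\dotsc$ coincide. Let $\mathscr{C}$ be the collection of all such continued fractions $[b_0,b_1,\dotsc]$, regarded as integer sequences. Define $\Phi\colon\mathscr{C}\to\mathscr{C}$ as follows. If $b_n\notin\{0,1,-1\}$ for every positive integer $n$ (ignoring $b_0$), then $\Phi$ fixes $[b_0,b_1,\dotsc]$. Otherwise let $m$ be the least positive integer for which $b_m\in\{0,1,-1\}$, and set $\Phi([b_0,b_1,\dotsc])$ equal to $[b_0,\dots,b_{m-2},\,b_{m-1}+b_{m+1},\,b_{m+2},b_{m+3},\dotsc]$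 if $b_m=0$; $[b_0,\dots,b_{m-2},\,b_{m-1}-1,\,b_{m+1}-1,\,b_{m+2},b_{m+3},\dotsc]$ if $b_m=1$; $[b_0,\dots,b_{m-2},\,b_{m-1}+1,\,b_{m+1}+1,\,b_{m+2},b_{m+3},\dotsc]$ if $b_m=-1$. (When $m=1$ the initial block $b_0,\dots,b_{m-2}$ is empty.) Given $[b_0,b_1,\dotsc]$, let $p^{(n)}$ be the first positive integer position (not zero; the coefficient with index $i$ has position $i$) at which a $0$, $1$ or $-1$ appears in $\Phi^n([b_0,b_1,\dotsc])$, and $p^{(n)}=\infty$ if there is no such position. Let $p=\liminf_{n\to\infty} p^{(n)}$. If $p=\infty$, then for each nonnegative integer $k$ the sequence of $k$th coefficients of $\Phi^n([b_0,b_1,\dotsc])$, $n=1,2,\dotsc$, is eventually constant with some value $b_k^*$; this gives the limit continued fraction $[b_0^*,b_1^*,\dotsc]$. If $p<\infty$, let $q^{(n)}$ be the modulus (absolute value) of the coefficient of $\Phi^n([b_0,b_1,\dotsc])$ at position $p-1$, for $n=1,2,\dotsc$. *)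

(* Defs.v *)
From mathcomp Require Import all_boot all_order all_algebra.
From mathcomp Require Import all_classical all_reals all_analysis.
Import Order.TTheory GRing.Theory Num.Theory.
Import numFieldNormedType.Exports.

Set Implicit Arguments.
Unset Strict Implicit.
Unset Printing Implicit Defensive.

Local Open Scope classical_set_scope.
Local Open Scope ring_scope.

(* The circle R u {oo}; the point oo is [None]. *)
Notation Rinfty R := (one_point_compactification R) (only parsing).

(* The infinite continued fraction [b_0, b_1, ...] is its sequence of
   coefficients. *)
Notation contfrac := (nat -> int) (only parsing).

Section convergents.
Variable R : realType.

Definition mobius (c : int) (z : Rinfty R) : Rinfty R :=
  match z with
  | None => Some c%:~R
  | Some x => if x == 0 then None else Some (c%:~R - x^-1)
  end.

Fixpoint mobius_comp (b : contfrac) (n : nat) (z : Rinfty R) : Rinfty R :=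
  if n is n'.+1 then mobius_comp b n' (mobius (b n) z) else mobius (b 0%N) z.

Definition convergent (b : contfrac) (n : nat) : Rinfty R :=
  mobius_comp b n None.

Definition converges_to (b : contfrac) (x : Rinfty R) : Prop :=
  convergent b n @[n --> \oo] --> x.

Definition diverges (b : contfrac) : Prop :=
  ~ exists x : Rinfty R, converges_to b x.

Definition ext_rational (z : Rinfty R) : Prop :=
  if z is Some x then rational x else True.

End convergents.

Definition same_tail (b c : contfrac) : Prop :=
  exists r s : nat, [/\ (0 < r)%N, (0 < s)%N &
    forall i : nat, b (r + i)%N = c (s + i)%N].

Definition small_at (b : contfrac) (m : nat) : bool :=
  (0 < m)%N && (b m \in [:: 0; 1; -1]).

(* [None] when no coefficient of positive index is 0, 1 or -1. *)
Definition first_small (b : contfrac) : option nat :=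
  if pselect (exists m, small_at b m) is left ex_m then Some (ex_minn ex_m)
  else None.

(* The coefficient b_m is removed together with b_{m+1} when b_m = 0, and alone
   otherwise; the indices of the later coefficients shift accordingly. *)
Definition contract (m : nat) (b : contfrac) : contfrac := fun i =>
  if (i < m.-1)%N then b i
  else if b m == 0 then
    if i == m.-1 then b m.-1 + b m.+1 else b i.+2
  else if b m == 1 then
    if i == m.-1 then b m.-1 - 1 else if i == m then b m.+1 - 1 else b i.+1
  else
    if i == m.-1 then b m.-1 + 1 else if i == m then b m.+1 + 1 else b i.+1.

Definition Phi (b : contfrac) : contfrac :=
  if first_small b is Some m then contract m b else b.

Definition Phi_iter (n : nat) (b : contfrac) : contfrac := iter n Phi b.

(* Each coefficient is the eventual value of the corresponding coefficient of
   [Phi_iter n b]; the default 0 is not used when the positions [pos] tend to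
   infinity, see [limit_cfP]. *)
Definition limit_cf (b : contfrac) : contfrac := fun k =>
  xget 0 [set c | \forall n \near \oo, Phi_iter n b k = c].

Section positions.
Variable R : realType.

Definition pos (b : contfrac) (n : nat) : \bar R :=
  if first_small (Phi_iter n b) is Some m then m%:R%:E else +oo%E.

Definition pos_to_infty (b : contfrac) : Prop :=
  pos b n @[n --> \oo] --> +oo%E.

(* A finite lower limit is a positive integer, see [liminf_posP]. *)
Definition liminf_pos (b : contfrac) : nat :=
  Num.truncn (fine (limn_einf (pos b))).

Definition modulus_before (b : contfrac) (n : nat) : nat :=
  `|Phi_iter n b (liminf_pos b).-1|%N.

Lemma contract_lt (m i : nat) (c : contfrac) :
  (i < m.-1)%N -> contract m c i = c i.
Proof. by rewrite /contract => ->. Qed.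

Lemma pos_ge1 (b : contfrac) (n : nat) : (1%:R%:E <= pos b n)%E.
Proof.
rewrite /pos /first_small; case: pselect => [h|_]; last exact: leey.
by case: ex_minnP => m /andP[m0 _] _; rewrite lee_fin ler_nat.
Qed.

Lemma pos_gtS (b : contfrac) (n k : nat) :
  (k%:R%:E < pos b n)%E -> (k.+1%:R%:E <= pos b n)%E.
Proof.
rewrite /pos; case: first_small => [m|_]; last exact: leey.
by rewrite lte_fin ltr_nat lee_fin ler_nat.
Qed.

Lemma limit_cfP (b : contfrac) : pos_to_infty b ->
  forall k, \forall n \near \oo, Phi_iter n b k = limit_cf b k.
Proof.
move=> /cvgeyPge posb k.
suff : exists c, \forall n \near \oo, Phi_iter n b k = c by exact: xgetPex.
have [N _ posN] := posb k.+2%:R.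
exists (Phi_iter N b k); exists N => // n /=; elim: n => [|n IHn].
  by rewrite leqn0 => /eqP ->.
rewrite leq_eqVlt => /orP[/eqP -> //|]; rewrite ltnS => Nn.
rewrite -(IHn Nn) /Phi_iter iterS; have := posN _ Nn; rewrite /= /pos /Phi_iter.
rewrite {2}/Phi; case: first_small => // m; rewrite lee_fin ler_nat => km.
by rewrite contract_lt//; case: m km.
Qed.

Lemma liminf_posP (b : contfrac) : ~ pos_to_infty b ->
  (0 < liminf_pos b)%N /\ limn_einf (pos b) = (liminf_pos b)%:R%:E.
Proof.
move=> /cvgeyPge/existsNP[A posA].
pose often k := `[< forall N, exists2 n, (N <= n)%N & (pos b n <= k%:R%:E)%E >].
have ex_often : exists k, often k.
  exists (Num.bound `|A|); apply/asboolP => N; apply: contrapT => nN.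
  apply: posA; exists N => // n /= Nn; apply: contrapT => /negP.
  rewrite -ltNge => /ltW posnA; apply: nN; exists n => //.
  apply: (le_trans posnA); rewrite lee_fin (le_trans (ler_norm A))//.
  by rewrite ltW// archi_boundP.
have [K /asboolP oftenK minK] := ex_minnP ex_often.
have K0 : (0 < K)%N.
  have [n _ posn] := oftenK 0%N.
  by have := le_trans (pos_ge1 b n) posn; rewrite lee_fin ler_nat.
have [N posN] : exists N, forall n, (N <= n)%N -> (K%:R%:E <= pos b n)%E.
  apply: contrapT => nposN; have : often K.-1.
    apply/asboolP => N; apply: contrapT => nN; apply: nposN; exists N => n Nn.
    rewrite -(prednK K0); apply: pos_gtS; rewrite ltNge; apply/negP => posn.
    by apply: nN; exists n.
  by move=> /minK; rewrite -ltnS (prednK K0) ltnn.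
have limK : limn_einf (pos b) = K%:R%:E.
  rewrite limn_einf_lim; apply/cvg_lim => //; apply: cvg_near_cst.
  exists N => // n /= Nn; apply/eqP; rewrite eq_le; apply/andP; split.
    have [m nm posm] := oftenK n; apply: (le_trans _ posm).
    by apply: ereal_inf_lbound; exists m.
  by apply: le_ereal_inf_tmp => _ [m /= nm <-]; exact/posN/(leq_trans Nn).
by rewrite /liminf_pos limK /= natrK.
Qed.

End positions.

(* Main.v *)
Require Import Defs.
From mathcomp Require Import all_boot all_order all_algebra.
From mathcomp Require Import all_classical all_reals all_analysis.
From mathcomp Require Import zify ring lra.
Import Order.TTheory GRing.Theory Num.Theory.
Import numFieldNormedType.Exports.

Set Implicit Arguments.
Unset Strict Implicit.
Unset Printing Implicit Defensive.

Local Open Scope classical_set_scope.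
Local Open Scope ring_scope.

(** Why the theorem holds.  Write S_n for [head_map b n], the composite of the
    first n maps s_(b_0), ..., s_(b_(n-1)).  Two identities govern everything:
    s_a s_0 s_d = s_(a + d) and, for e = 1 or -1, s_a s_e s_d = s_(a-e) s_(d-e).
    They say that a contraction deletes one or two convergents and keeps all the
    others in order ([convergent_Phi]), so the convergents of each iterate of
    [Phi] are, from some index on, convergents of the original continued
    fraction ([convergent_Phi_iter]).  In geometric terms the convergents are
    the vertices of a path in the Farey graph, and [Phi] removes its first
    backtrack or shortcut.

    The point of the algorithm is that no convergent escapes it.  If position
    p^(s) exceeds K for all late s, then every late convergent v_n occurs as a
    convergent of index i >= K of some late iterate c, at a time when it is not
    behind the first small coefficient, so that |c_j| >= 2 for 0 < j < i
    ([convergent_clear_from]).  Maps s_a with |a| >= 2 send the set of points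
    infinity or of modulus at least 1 to itself, and therefore v_n = S_k(z) with
    z infinite or |z| >= |c_k| - 1, for each k <= i ([convergent_far]).

    When the positions tend to infinity, the first coefficients of c are those
    of the limit continued fraction c', all of modulus at least 2 except
    perhaps the first.  Then v_n lies in the cylinder S_k(|z| >= 1) of c'.  With
    p_k / q_k the convergents of c', a point v is in this cylinder when
    |q_(k-1) v - p_(k-1)| <= |q_(k-2) v - p_(k-2)|, and u_n = q_(n-2) v - p_(n-2)
    satisfies the recurrence u_(n+2) = c'_n u_(n+1) - u_n.  As |q_k| grows
    strictly, the cylinders shrink to one point x, the limit.  If x is rational,
    multiplying by its denominator turns q_k x - p_k into integers of
    nonincreasing modulus; where the modulus is constant the recurrence forces
    all later coefficients to be 2, or all to be -2 ([rational_tail2]).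
    Conversely such a tail makes q_k x - p_k an arithmetic progression up to
    alternating signs; it is bounded, hence constant, and x is rational
    ([tail2_rational]).

    When the lower limit of the positions is P + 1, the coefficients before
    position P freeze, and with them U = S_P, a homeomorphism of the circle.
    If the coefficients c_P of the iterates tend to infinity in modulus, then
    every late convergent is U(z) with |z| large, and the limit is U(infinity).
    Otherwise suppose that the convergents converge.  Every late value c_P
    yields a convergent U(c_P) of arbitrarily late index, so the integers c_P
    converge in the circle; having a bounded subsequence they are eventually
    constant.  But a contraction at position P + 1 changes c_P when the removed
    coefficient is 1 or -1, and produces the convergent U(infinity) when it is
    0: a contradiction ([bounded_diverges]). *)

(** * Mobius maps and contractions *)

Section MobiusAlgebra.
Context {R : realType}.
Implicit Types (b c : nat -> int) (z w : one_point_compactification R).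

Fixpoint head_map b n z : one_point_compactification R :=
  if n is n'.+1 then head_map b n' (mobius (b n') z) else z.

Lemma convergentE b n : convergent R b n = head_map b n.+1 None.
Proof.
by rewrite /convergent; elim: n (None : one_point_compactification R) => //=.
Qed.

Lemma eq_head_map b c n z :
  (forall j, (j < n)%N -> b j = c j) -> head_map b n z = head_map c n z.
Proof.
elim: n z => //= n IH z bc; rewrite (bc n) ?ltnSn// IH// => j jn.
by apply: bc; rewrite ltnW.
Qed.

Definition translate (e : int) z : one_point_compactification R :=
  omap (fun x => x + e%:~R) z.

Lemma mobius_translate (d e : int) z :
  mobius (d + e) z = translate e (mobius d z).
Proof.
case: z => [x|] /=; last by rewrite rmorphD.
by case: eqP => //= _; rewrite rmorphD/= addrAC.
Qed.

Lemma mobius_mobius0 (a : int) z : mobius a (mobius 0 z) = translate a z.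
Proof.
case: z => [x|] /=; last by rewrite eqxx.
have [->/=|x0] := eqVneq x 0; first by rewrite add0r.
by rewrite sub0r /= oppr_eq0 invr_eq0 (negbTE x0) invrN invrK opprK addrC.
Qed.

(** Writing s_e(z) = (e z - 1) / z with e^2 = 1, one gets
    a - 1 / s_e(z) = (a - e) - 1 / (z - e). *)
Lemma mobius_mobius_unit (a e : int) z : e * e = 1 ->
  mobius a (mobius e z) = mobius (a - e) (translate (- e) z).
Proof.
move=> ee; have eeR : e%:~R * e%:~R = 1 :> R by rewrite -rmorphM/= ee.
have e0 : e%:~R != 0 :> R.
  by apply/eqP => eq0; move: eeR; rewrite eq0 mul0r => /eqP; rewrite eq_sym oner_eq0.
have eV : (e%:~R : R)^-1 = e%:~R := mulr1_eq eeR.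
case: z => [x|] /=; last by rewrite (negbTE e0) eV rmorphB.
rewrite rmorphN/= subr_eq0.
have [->|x0] := eqVneq x 0.
  by rewrite eq_sym (negbTE e0) sub0r invrN eV rmorphB/= opprK subrK.
rewrite /= subr_eq0; have [->|xe] := eqVneq x (e%:~R); first by rewrite eV eqxx.
have -> : ((e%:~R : R) == x^-1) = false.
  by apply/negbTE; apply: contra xe => /eqP ex; rewrite -eV ex invrK.
congr Some; rewrite rmorphB/=.
have x'e : x - e%:~R != 0 by rewrite subr_eq0.
suff -> : (e%:~R - x^-1 : R)^-1 = e%:~R + (x - e%:~R)^-1 by rewrite opprD addrA.
apply: mulr1_eq; set E := e%:~R in eeR x'e *.
have -> : (E - x^-1) * (E + (x - E)^-1)
  = 1 + (E * E - 1) * (1 + (x - E)^-1 * x^-1) by field; rewrite x0.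
by rewrite eeR subrr mul0r addr0.
Qed.

(** Once two composites agree after k steps, equal later coefficients keep them
    equal; the shift d is the number of coefficients lost by a contraction. *)
Lemma head_map_shift {d} b c k n z : (k <= n)%N ->
  (forall i, (k <= i)%N -> c i = b (i + d)%N) ->
  (forall z', head_map c k z' = head_map b (k + d) z') ->
  head_map c n z = head_map b (n + d) z.
Proof.
move=> kn cb H; elim: n kn z => [|n IH]; first by rewrite leqn0 => /eqP <-.
rewrite leq_eqVlt => /orP[/eqP <- //|kn] z /=.
by rewrite cb// IH.
Qed.

(** Number of coefficients that a contraction removes. *)
Definition contract_size (e : int) : nat := if e == 0 then 2 else 1.

Lemma contract_size_gt0 e : (0 < contract_size e)%N.
Proof. by rewrite /contract_size; case: ifP. Qed.

(** The convergents of index below m - 1 are unchanged; the deleted ones have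
    index m - 1, and also m when b_m = 0. *)
Lemma convergent_contract b m j : small_at b m -> (m.-1 <= j)%N ->
  convergent R (Defs.contract m b) j = convergent R b (j + contract_size (b m)).
Proof.
move=> /andP[+ bm]; case: m bm => // P bm _ /= Pj.
rewrite !convergentE -addSn /contract_size.
have lowE i z : (i <= P)%N -> head_map (Defs.contract P.+1 b) i z = head_map b i z.
  move=> iP; apply: eq_head_map => k ki; rewrite /Defs.contract /=.
  by rewrite (leq_trans ki iP).
have [bm0|bm0] := eqVneq (b P.+1) 0.
  apply: (@head_map_shift _ _ _ P.+1) => //.
    move=> i Pi; rewrite /Defs.contract /= ltnNge (ltnW Pi)/= bm0 eqxx.
    by rewrite gtn_eqF// addn2.
  move=> z; rewrite /= lowE// addn2 /= bm0 mobius_mobius0 -mobius_translate addrC.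
  by rewrite /Defs.contract /= ltnn bm0 !eqxx.
have bm1 : b P.+1 = 1 \/ b P.+1 = -1.
  move: bm; rewrite !inE (negbTE bm0) /= => /orP[]/eqP ->; by [left|right].
have ee : b P.+1 * b P.+1 = 1 by case: bm1 => ->.
have PE : Defs.contract P.+1 b P = b P - b P.+1.
  rewrite /Defs.contract /= ltnn (negbTE bm0) eqxx.
  by case: bm1 => ->.
have SE : Defs.contract P.+1 b P.+1 = b P.+2 - b P.+1.
  rewrite /Defs.contract /= ltnNge leqnSn/= (negbTE bm0) eqxx gtn_eqF//.
  by case: bm1 => ->.
(* At index P the composites differ, but not their values at infinity. *)
move: Pj; rewrite leq_eqVlt => /orP[/eqP <-|Pj].
  rewrite addn1 -[RHS]/(head_map b P (mobius (b P) (mobius (b P.+1) None))).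
  by rewrite mobius_mobius_unit//= lowE// PE.
apply: (@head_map_shift _ _ _ P.+2) => //.
  move=> i Pi; rewrite /Defs.contract /= ltnNge (leq_trans _ Pi)/=; last by lia.
  by rewrite (negbTE bm0) !gtn_eqF ?addn1//; [case: ifP|lia].
move=> z; rewrite addn1 -[RHS]/(head_map b P
  (mobius (b P) (mobius (b P.+1) (mobius (b P.+2) z)))).
by rewrite mobius_mobius_unit// -mobius_translate /= lowE// PE SE.
Qed.

End MobiusAlgebra.

(** * Iterating the contractions *)

Section Dynamics.
Implicit Types (b c : nat -> int).

Lemma not_small_at c j : (0 < j)%N -> ~~ small_at c j = (1 < `|c j|)%N.
Proof.
by move=> j0; rewrite /small_at j0 /= !inE; apply/idP/idP; lia.
Qed.

Variant first_small_spec c : option nat -> Prop :=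
| FirstSmallNone of (forall j, (0 < j)%N -> (1 < `|c j|)%N) :
    first_small_spec c None
| FirstSmallSome m of small_at c m
    & (forall j, (0 < j < m)%N -> (1 < `|c j|)%N) : first_small_spec c (Some m).

Lemma first_smallP c : first_small_spec c (first_small c).
Proof.
rewrite /first_small; case: pselect => [ex_m|no_m].
  case: ex_minnP => m small_m minm; constructor => // j /andP[j0 jm].
  by rewrite -not_small_at//; apply: contraL jm => /minm; rewrite -leqNgt.
constructor => j j0; rewrite -not_small_at//; apply/negP => small_j.
by apply: no_m; exists j.
Qed.

(** This is the condition p > K on the position p of the first small
    coefficient, see [clear_uptoP]. *)
Definition clear_upto (K : nat) c := forall j, (0 < j <= K)%N -> (1 < `|c j|)%N.

Lemma clear_uptoP K c :
  clear_upto K c <-> forall m, first_small c = Some m -> (K < m)%N.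
Proof.
case: first_smallP => [big|m small_m big].
  by split => // _ j /andP[j0 _]; exact: big.
split=> [clearK _ [<-]|/(_ m erefl) Km j /andP[j0 jK]].
  rewrite ltnNge; apply/negP => mK; have m0 : (0 < m)%N by case/andP: small_m.
  by move: small_m; apply/negP; rewrite not_small_at// clearK// m0.
by apply: big; rewrite j0 (leq_ltn_trans jK).
Qed.

Lemma Phi_lt K c j : clear_upto K c -> (j < K)%N -> Phi c j = c j.
Proof.
move=> /clear_uptoP; rewrite /Phi; case: first_small => // m /(_ m erefl) Km jK.
by rewrite contract_lt//; lia.
Qed.

Lemma Phi_iter_lt K T b :
  (forall s, (T <= s)%N -> clear_upto K (Phi_iter s b)) ->
  forall s j, (T <= s)%N -> (j < K)%N -> Phi_iter s b j = Phi_iter T b j.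
Proof.
move=> clearK s j Ts jK; elim: s Ts => [|s IH]; first by rewrite leqn0 => /eqP->.
rewrite leq_eqVlt => /orP[/eqP->//|]; rewrite ltnS => Ts.
by rewrite -(IH Ts) /Phi_iter iterS (Phi_lt (clearK s Ts)).
Qed.

Lemma Phi_before_unit c P : first_small c = Some P.+1 -> c P.+1 != 0 ->
  Phi c P = c P - c P.+1.
Proof.
move=> cP cP0; rewrite /Phi cP; case: first_smallP cP => // m /andP[_ +] _ [mP].
rewrite mP !inE (negbTE cP0) /= => cP1.
rewrite /Defs.contract /= ltnn (negbTE cP0) eqxx.
by case/orP: cP1 => /eqP ->.
Qed.

Lemma first_small_gt0 c m : first_small c = Some m -> (0 < m)%N.
Proof. by case: first_smallP => // k /andP[k0 _] _ [<-]. Qed.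

Lemma clear_upto_pred c m : first_small c = Some m -> clear_upto m.-1 c.
Proof.
move=> cm; apply/clear_uptoP => k; rewrite cm => -[<-].
by rewrite prednK// (first_small_gt0 cm).
Qed.

(** A contraction at m leaves the coefficients before m - 1 alone, so the
    position of the first small coefficient decreases by at most one. *)
Lemma first_small_Phi c m m' : first_small c = Some m ->
  first_small (Phi c) = Some m' -> (m <= m'.+1)%N.
Proof.
move=> cm; have clear_c := clear_upto_pred cm.
suff /clear_uptoP H : clear_upto m.-2 (Phi c) by move=> /H; lia.
move=> j jm; rewrite (Phi_lt clear_c); last by lia.
by apply: clear_c; lia.
Qed.

End Dynamics.

Section Tracking.
Context {R : realType}.
Implicit Types (b c : nat -> int).

Lemma convergent_Phi c m j : first_small c = Some m -> (m.-1 <= j)%N ->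
  convergent R (Phi c) j = convergent R c (j + contract_size (c m)).
Proof.
move=> cm mj; rewrite /Phi cm convergent_contract//.
by case: first_smallP cm => // k small_k _ [<-].
Qed.

(** The second clause locates the range where the identity holds: it starts at
    or before the first small position of the iterate, which is what makes each
    contraction visible among the original convergents.  The shift d is at least
    t because each contraction deletes a convergent. *)
Lemma convergent_Phi_iter b t : exists N d,
  (forall j, (N <= j)%N ->
    convergent R (Phi_iter t b) j = convergent R b (j + d)) /\
  (forall m, first_small (Phi_iter t b) = Some m -> (N <= m)%N /\ (t <= d)%N).
Proof.
elim: t => [|t [N [d [bE Nd]]]].
  by exists 0%N, 0%N; split=> // j _; rewrite addn0.
rewrite /Phi_iter iterS -/(Phi_iter t b); set c := Phi_iter t b in bE Nd *.
case cm: (first_small c) => [m|]; last first.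
  exists N, d; have -> : Phi c = c by rewrite /Phi cm.
  by split => // m; rewrite cm.
have [Nm td] := Nd m cm.
have m0 := first_small_gt0 cm.
have size0 := contract_size_gt0 (c m).
exists m.-1, (contract_size (c m) + d)%N; split=> [j mj|m' m'E].
  by rewrite (convergent_Phi cm mj) bE ?addnA//; lia.
by have := first_small_Phi cm m'E; lia.
Qed.

(** Either the n-th convergent is not behind the first small position of c, or
    the contraction lowers its index without deleting it and one concludes by
    induction.  Its index never drops below K because contractions happen at
    positions greater than K. *)
Lemma convergent_clear K c :
  (forall s, clear_upto K (Phi_iter s c)) -> forall n, (K <= n)%N ->
  exists s i, [/\ (K <= i)%N, clear_upto i.-1 (Phi_iter s c) &
    convergent R c n = convergent R (Phi_iter s c) i].
Proof.
move=> + n; have [k] := ubnP n; elim: k => // k IH in n c *.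
rewrite ltnS => nk clearK Kn.
have [clear_n|] := pselect (clear_upto n.-1 c); first by exists 0%N, n.
case cm: (first_small c) => [m|] not_clear; last first.
  by exfalso; apply: not_clear; apply/clear_uptoP => m; rewrite cm.
have mn : (m < n)%N.
  rewrite ltnNge; apply/negP => nm; apply: not_clear => j jn.
  by apply: (clear_upto_pred cm); lia.
have Km := (clear_uptoP K c).1 (clearK 0%N) m cm.
have [s01 s2] : (0 < contract_size (c m))%N /\ (contract_size (c m) <= 2)%N.
  by rewrite /contract_size; case: ifP.
have [|s||s [i [Ki clear_i E]]] := IH (n - contract_size (c m))%N (Phi c).
- by lia.
- by have := clearK s.+1; rewrite /Phi_iter iterSr.
- by lia.
exists s.+1, i; rewrite /Phi_iter iterSr; split => //; rewrite -/(Phi_iter s _) -E.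
rewrite (convergent_Phi cm); last by lia.
by congr convergent; lia.
Qed.

Lemma convergent_clear_from K T b :
  (forall s, (T <= s)%N -> clear_upto K (Phi_iter s b)) ->
  exists N, forall n, (N <= n)%N ->
  exists s i, [/\ (T <= s)%N, (K <= i)%N, clear_upto i.-1 (Phi_iter s b) &
    convergent R b n = convergent R (Phi_iter s b) i].
Proof.
move=> clearK; have [N [d [bE _]]] := convergent_Phi_iter b T.
exists (N + K + d)%N => n Nn.
have [s||s [i [Ki clear_i E]]] := @convergent_clear K (Phi_iter T b) _ (n - d)%N.
- by rewrite /Phi_iter -iterD; apply: clearK; exact: leq_addl.
- by lia.
exists (s + T)%N, i; rewrite /Phi_iter iterD; split => //; first exact: leq_addl.
by rewrite -/(Phi_iter T b) -E bE; [congr convergent|]; lia.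
Qed.

End Tracking.

(** * The topology of the circle *)

Section Circle.
Context {R : realType}.
Notation circle := (one_point_compactification R).
Implicit Types (b c : nat -> int) (z w : circle).

(** These sets form a basis of neighbourhoods of infinity, see [nbhs_inftyP]. *)
Definition far (r : R) z : bool := if z is Some x then r <= `|x| else true.

Lemma far_le r s z : r <= s -> far s z -> far r z.
Proof. by case: z => //= x; exact: le_trans. Qed.

Lemma far_nbhs_infty r : nbhs (None : circle) [set z | far r z].
Proof.
exists `[- r, r]%classic.
  by split; [exact: segment_compact | exact: itv_closed].
move=> _ [[x /= xr <-]|->] //=; rewrite leNgt; apply/negP => /ltW.
rewrite ler_norml => xr'.
by apply: xr; rewrite /= in_itv.
Qed.

Lemma nbhs_inftyP (U : set circle) : nbhs (None : circle) U <->
  exists r, forall z, far r z -> U z.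
Proof.
split=> [[C [/compact_bounded[M [_ bdC]] _] CU]|[r rU]]; last first.
  by apply: filterS (far_nbhs_infty r) => z; exact: rU.
exists (M + 2) => z /= zM; apply: CU; case: z zM => [x|] /= xM; [left|by right].
exists x => // Cx; have M1 : M < M + 1 by rewrite ltrDl.
by have := le_trans xM (bdC _ M1 x Cx); lra.
Qed.

Lemma cvg_infty {T} {F : set_system T} {FF : Filter F} (f : T -> circle) :
  (forall r, \forall t \near F, far r (f t)) -> f @ F --> (None : circle).
Proof.
by move=> f_far U /nbhs_inftyP[r rU]; apply: filterS (f_far r) => t; exact: rU.
Qed.

Lemma nbhs_SomeP (x : R) (U : set circle) : nbhs (Some x : circle) U <->
  exists2 e : R, 0 < e & forall y, `|x - y| < e -> U (Some y).
Proof.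
split=> [/(nbhs_normP x (fun y => U (Some y)))[e e0 eU]|[e e0 eU]].
  by exists e => // y xy; apply: eU.
by apply/(nbhs_normP x (fun y => U (Some y))); exists e => // y xy; apply: eU.
Qed.

Lemma mobius_continuous (a : int) : continuous (@mobius R a).
Proof.
case=> [x|]; last first.
  move=> U /= /nbhs_SomeP[e e0 eU].
  apply: (filterS _ (far_nbhs_infty (2 / e))) => -[y|_] /=; last first.
    by apply: eU; rewrite subrr normr0.
  have e2 : 0 < 2 / e by rewrite divr_gt0.
  move=> ye; have y0 : y != 0 by rewrite -normr_gt0 (lt_le_trans e2).
  rewrite (negbTE y0); apply: eU; rewrite opprB addrC subrK normfV.
  rewrite invf_plt ?posrE ?normr_gt0//; apply: lt_le_trans ye.
  by rewrite -[ltLHS]mul1r ltr_pM2r ?invr_gt0// ltr1n.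
have [->|x0] := eqVneq x 0.
  rewrite /continuous_at /= eqxx; apply: cvg_infty => r.
  apply/nbhs_SomeP; set M := `|r| + `|a%:~R| + 1.
  have M0 : 0 < M by rewrite ltr_wpDl// addr_ge0.
  exists M^-1; rewrite ?invr_gt0// => y; rewrite sub0r normrN /= => yM.
  have [//|y0] := eqVneq y 0.
  rewrite /=; have : M < `|y^-1|.
    by rewrite normfV -[M]invrK ltf_pV2// posrE ?invr_gt0 ?normr_gt0.
  have := lerB_dist (y^-1) (a%:~R); rewrite distrC.
  by have := ler_norm r; rewrite /M; lra.
rewrite /continuous_at /= (negbTE x0).
have h : (fun y : R => Some (a%:~R - y^-1) : circle) @ x -->
    (Some (a%:~R - x^-1) : circle).
  apply: (@cvg_comp _ _ _ (fun y : R => a%:~R - y^-1) (@Some R : R -> circle)); last first.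
    exact: one_point_compactification_some_continuous.
  by apply: cvgB; [exact: cvg_cst | exact: cvgV].
move=> U /h hU; change (\forall y \near x, U (mobius a (Some y))).
have near_x0 : \forall y \near x, y != 0.
  by apply: open_nbhs_nbhs; split => //; exact: open_neq.
near=> y; have /negbTE y0 : y != 0 by near: y.
by rewrite /mobius y0; near: y; exact: hU.
Unshelve. all: by end_near. Qed.

Lemma head_map_continuous b n : continuous (head_map b n : circle -> circle).
Proof.
elim: n => [|n IH] z /=; first exact: cvg_id.
apply: (@cvg_comp _ _ _ (mobius (b n)) (head_map b n)); last exact: IH.
exact: mobius_continuous.
Qed.

(** As [s_0] is an involution and [s_a s_0 s_d = s_(a + d)], the inverse of
    [s_a] is [s_0 s_(- a) s_0]: its continuity is that of the maps [s_a]. *)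
Definition mobius_inv (a : int) z : circle := mobius 0 (mobius (- a) (mobius 0 z)).

Lemma mobiusK (a : int) : cancel (mobius a) (mobius_inv a : circle -> circle).
Proof.
move=> z; rewrite /mobius_inv mobius_mobius0 -mobius_translate subrr.
by rewrite mobius_mobius0; case: z => //= x; rewrite addr0.
Qed.

Fixpoint head_inv b n z : circle :=
  if n is n'.+1 then mobius_inv (b n') (head_inv b n' z) else z.

Lemma head_mapK b n : cancel (head_map b n) (head_inv b n : circle -> circle).
Proof. by elim: n => //= n IH z; rewrite IH mobiusK. Qed.

Lemma head_inv_continuous b n : continuous (head_inv b n : circle -> circle).
Proof.
elim: n => [|n IH] z /=; first exact: cvg_id.
apply: (@cvg_comp _ _ _ (head_inv b n) (mobius_inv (b n))); first exact: IH.
apply: (@cvg_comp _ _ _ (mobius 0) (mobius 0 \o mobius (- b n))).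
  exact: mobius_continuous.
apply: (@cvg_comp _ _ _ (mobius (- b n)) (mobius 0)); exact: mobius_continuous.
Qed.

Lemma far_mobius (a : int) z : far 1 z \/ z = Some 0 ->
  far (`|a|%N%:R - 1) (mobius a z).
Proof.
rewrite natr_absz intr_norm.
case=> [|->] /=; last by rewrite eqxx.
case: z => [x|_] /=; last by rewrite lerBlDr lerDl.
move=> x1; have x0 : x != 0 by rewrite -normr_gt0 (lt_le_trans ltr01).
rewrite (negbTE x0) /=; have := lerB_dist (a%:~R) (x^-1).
have : `|x^-1| <= 1 by rewrite normfV invf_le1// normr_gt0.
lra.
Qed.

Lemma far1_mobius (a : int) z : (1 < `|a|)%N -> far 1 z \/ z = Some 0 ->
  far 1 (mobius a z).
Proof.
move=> a1 /(far_mobius a); apply: far_le.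
by rewrite lerBrDr -[leLHS]/2 ler_nat.
Qed.

(** The set [far 1] is stable under s_a for |a| >= 2, so the innermost maps can
    be absorbed in the argument. *)
Lemma head_map_far c k n z : (k <= n)%N -> far 1 z ->
  (forall j, (k <= j < n)%N -> (1 < `|c j|)%N) ->
  exists2 w, far 1 w & head_map c n z = head_map c k w.
Proof.
elim: n z => [|n IH] z; first by rewrite leqn0 => /eqP-> z1 _; exists z.
rewrite leq_eqVlt => /orP[/eqP-> z1 _|kn z1 big]; first by exists z.
apply: IH => //=; first by apply: far1_mobius; [apply: big; lia|left].
by move=> j jn; apply: big; lia.
Qed.

(** The coefficient c_i may be 0 and c_k is arbitrary; only the coefficients in
    between need modulus at least 2. *)
Lemma convergent_far c k i : (k <= i)%N ->
  (forall j, (k < j < i)%N -> (1 < `|c j|)%N) ->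
  exists2 z, far (`|c k|%N%:R - 1) z & convergent R c i = head_map c k z.
Proof.
move=> ki big; suff [w w1 ->] : exists2 w, far 1 w \/ w = Some 0 &
    convergent R c i = head_map c k.+1 w.
  by exists (mobius (c k) w) => //; exact: far_mobius.
rewrite convergentE.
move: ki; rewrite leq_eqVlt => /orP[/eqP->|]; first by exists None => //; left.
have int_far (a : int) : far 1 (Some a%:~R : circle) \/ Some a%:~R = Some 0 :> circle.
  have [->|a0] := eqVneq a 0; [by right|left].
  by rewrite /= -intr_norm -[1]/(1%:~R) ler_int; lia.
rewrite leq_eqVlt => /orP[/eqP ki|ki]; first by rewrite -ki; exists (Some (c k.+1)%:~R).
case: i => [//|i] in big ki *.
rewrite [head_map c i.+2 _]/=.
have [||j|w w1 ->] := @head_map_far c k.+1 i (mobius (c i) (Some (c i.+1)%:~R)).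
- by lia.
- by apply: far1_mobius => //; apply: big; lia.
- by move=> ?; apply: big; lia.
by exists w => //; left.
Qed.

End Circle.

(** * Numerators and denominators *)

Section Recurrence.
Context {K : comPzRingType}.
Implicit Types (c : nat -> int) (x y : K).

Fixpoint recur c x y n : K :=
  if n is n'.+1 then
    if n' is n''.+1 then (c n'')%:~R * recur c x y n' - recur c x y n'' else y
  else x.

Lemma recurSS c x y n :
  recur c x y n.+2 = (c n)%:~R * recur c x y n.+1 - recur c x y n.
Proof. by []. Qed.

Lemma nat_ind2 (P : nat -> Prop) :
  P 0%N -> P 1%N -> (forall n, P n -> P n.+1 -> P n.+2) -> forall n, P n.
Proof.
move=> P0 P1 PS n; suff [] : P n /\ P n.+1 by [].
by elim: n => // n [Pn PSn]; split => //; exact: PS.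
Qed.

Lemma recur_lin c (a x y x' y' : K) n :
  recur c (a * x + x') (a * y + y') n = a * recur c x y n + recur c x' y' n.
Proof.
elim/nat_ind2: n => // n IH1 IH2; rewrite !recurSS IH1 IH2.
by ring.
Qed.

(** The Casorati determinant of two solutions is constant, as the recurrence
    has determinant 1. *)
Lemma recur_casorati c x y x' y' n :
  recur c x y n * recur c x' y' n.+1 - recur c x y n.+1 * recur c x' y' n
  = x * y' - y * x'.
Proof. by elim: n => // n <-; rewrite !recurSS; ring. Qed.

End Recurrence.

Arguments recur {K} c x y n : simpl nomatch.

Lemma recur_intr (K : comPzRingType) c (x y : int) n :
  (recur c x y n)%:~R = recur c (x%:~R : K) y%:~R n.
Proof.
elim/nat_ind2: n => // n IH1 IH2.
by rewrite !recurSS rmorphB rmorphM /= IH1 IH2 intz.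
Qed.

Section Regular.
Context {R : realType}.
Implicit Types (c : nat -> int) (v x : R).

(** With p_k / q_k the convergents of c and the conventions p_(-1) = 1,
    q_(-1) = 0, p_(-2) = 0, q_(-2) = -1, the sequences [error c v] and [den c]
    are p_(n-2) - q_(n-2) v and - q_(n-2). *)
Definition error c v n : R := recur c v 1 n.
Definition den c n : R := recur c 1 0 n.

(** As [error c v n] is z times [error c v n.+1] when v is [head_map c n z],
    these are the finite values of [head_map c n] on infinity and on the points
    of modulus at least 1. *)
Definition cylinder c n : set R :=
  [set v | `|error c v n.+1| <= `|error c v n|].

Lemma head_map_error c n z v : head_map c n z = Some v ->
  if z is Some x then error c v n = x * error c v n.+1 else error c v n.+1 = 0.
Proof.
elim: n z => [|n IH] z /=; first by move=> -> /=; rewrite /error /= mulr1.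
move=> /IH; case: z => [x|] /=.
  rewrite [error c v n.+2]recurSS -!/(error _ _ _).
  have [->|x0] := eqVneq x 0; first by rewrite mul0r.
  by move=> ->; field.
by rewrite [error c v n.+2]recurSS -!/(error _ _ _) => ->; rewrite subrr.
Qed.

Lemma head_map_cylinder c n z : (0 < n)%N -> clear_upto n.-1 c -> far 1 z ->
  exists2 v, head_map c n z = Some v & cylinder c n v.
Proof.
move=> n0 clear_c z1; have [|j jn|w w1] := @head_map_far R c 1 n z _ z1.
- by [].
- by apply: clear_c; lia.
have [v vE] : exists v : R, head_map c 1 w = Some v.
  case: w w1 => [x|_]; last by exists (c 0)%:~R.
  rewrite /= => x1; have x0 : x != 0 by rewrite -normr_gt0 (lt_le_trans ltr01).
  by rewrite (negbTE x0); eexists.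
rewrite vE => zv; exists v => //; rewrite /cylinder /=.
have := head_map_error zv; case: z z1 {zv} => [x|_] /=.
  by move=> x1 ->; rewrite normrM ler_peMl.
by move=> ->; rewrite normr0.
Qed.

Lemma intr_norm_ge2 (a : int) : (1 < `|a|)%N -> 2 <= `|a%:~R| :> R.
Proof. by move=> a1; rewrite -intr_norm -[2]/(2%:~R) ler_int; lia. Qed.

(** Writing e_n for the errors, if |e_(n+2)| <= |e_(n+1)| and |c_n| >= 2, then
    e_n = c_n e_(n+1) - e_(n+2) has modulus at least 2 |e_(n+1)| - |e_(n+1)|. *)
Lemma cylinder_pred c n : (0 < n)%N -> (1 < `|c n|)%N ->
  cylinder c n.+1 `<=` cylinder c n.
Proof.
move=> n0 /intr_norm_ge2 cn v; rewrite /cylinder /= {1}/error recurSS -!/(error _ _ _).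
set e := error c v n; set e' := error c v n.+1 => H.
have := lerB_dist ((c n)%:~R * e') e; rewrite normrM.
have : 2 * `|e'| <= `|(c n)%:~R| * `|e'| by rewrite ler_wpM2r.
lra.
Qed.

Lemma cylinder_le c m n : clear_upto n.-1 c -> (0 < m <= n)%N ->
  cylinder c n `<=` cylinder c m.
Proof.
elim: n => [|n IH] clear_c; first by case: m.
move=> /andP[m0]; rewrite leq_eqVlt => /orP[/eqP->//|]; rewrite ltnS => mn v vn.
apply: IH; first by move=> j jn; apply: clear_c; lia.
  by rewrite m0.
by apply: cylinder_pred vn; [lia|apply: clear_c; lia].
Qed.

(** As |d_(n+2)| >= 2 |d_(n+1)| - |d_n|, the increments of the moduli of the
    denominators do not decrease; the first one is 1. *)
Lemma den_growth c n : clear_upto n c -> `|den c n.+1| + 1 <= `|den c n.+2|.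
Proof.
elim: n => [|n IH] clear_c.
  by rewrite /den /= mulr0 sub0r normrN normr0 normr1 add0r.
have {}IH := IH (fun j jn => clear_c j ltac:(lia)).
have /intr_norm_ge2 cn : (1 < `|c n.+1|)%N by apply: clear_c; lia.
rewrite {2}/den recurSS -!/(den _ _).
set d := den c n.+1 in IH *; set d' := den c n.+2 in IH *.
have := lerB_dist ((c n.+1)%:~R * d') d; rewrite normrM.
have : 2 * `|d'| <= `|(c n.+1)%:~R| * `|d'| by rewrite ler_wpM2r.
lra.
Qed.

Lemma den_ge c n : clear_upto n.-1 c -> n%:R <= `|den c n.+1|.
Proof.
elim: n => [|n IH] clear_c; first by [].
apply: le_trans (den_growth clear_c).
by rewrite -natr1 lerD2r IH// => j jn; apply: clear_c; lia.
Qed.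

Lemma errorB c v w n : error c v n - error c w n = (v - w) * den c n.
Proof.
have -> : error c v n = (v - w) * den c n + error c w n.
  by rewrite -recur_lin mulr1 mulr0 subrK add0r.
by rewrite addrK.
Qed.

(** The Casorati determinant of the errors and the denominators is -1, hence
    |e_n| |d_(n+1)| - |e_(n+1)| |d_n| <= 1; use |e_(n+1)| <= |e_n| and
    |d_n| + 1 <= |d_(n+1)|. *)
Lemma error_le1 c n v : (0 < n)%N -> clear_upto n c -> cylinder c n v ->
  `|error c v n.+1| <= 1.
Proof.
case: n => // n _ clear_c; rewrite /cylinder /=.
have := recur_casorati c v 1 1 0 n.+1; rewrite -!/(error _ _ _) -!/(den _ _).
have := @den_growth c n (fun j jn => clear_c j ltac:(lia)).
set e := error _ _ n.+1; set e' := error _ _ n.+2.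
set d := den _ n.+1; set d' := den _ n.+2 => dd eq1 ee.
have : `|e| * `|d'| - `|e'| * `|d| <= 1.
  rewrite -!normrM; apply: le_trans (lerB_dist _ _) _.
  by rewrite eq1 mulr0 mulr1 sub0r normrN normr1.
have : `|e'| * `|d'| <= `|e| * `|d'| by rewrite ler_wpM2r.
have : `|e'| * (`|d| + 1) <= `|e'| * `|d'| by rewrite ler_wpM2l.
lra.
Qed.

Lemma cylinder_dist c n v w : (0 < n)%N -> clear_upto n c ->
  cylinder c n v -> cylinder c n w -> `|v - w| <= 2 / n%:R.
Proof.
move=> n0 clear_c vI wI; rewrite ler_pdivlMr ?ltr0n//.
have := @den_ge c n (fun j jn => clear_c j ltac:(lia)).
move=> /(ler_wpM2l (normr_ge0 (v - w)))/le_trans; apply.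
rewrite -normrM -errorB; apply: le_trans (ler_normB _ _) _.
by rewrite -[leRHS]/(1 + 1) lerD// error_le1.
Qed.

End Regular.

(** * Continued fractions with coefficients of modulus at least 2 *)

Section RegularLimit.
Context {R : realType}.
Implicit Types (c : nat -> int) (v x : R).

Definition regular c := forall j, (0 < j)%N -> (1 < `|c j|)%N.

Lemma regular_clear c n : regular c -> clear_upto n c.
Proof. by move=> reg_c j /andP[j0 _]; exact: reg_c. Qed.

Lemma two_div_natr_lt (e : R) : 0 < e -> exists2 m, (0 < m)%N & 2 / m%:R < e.
Proof.
move=> e0; exists (Num.bound (2 / e)).+1 => //.
rewrite ltr_pdivrMr ?ltr0n// mulrC -ltr_pdivrMr//.
apply: lt_trans (archi_boundP _) _; first by rewrite divr_ge0// ltW.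
by rewrite ltr_nat.
Qed.

Lemma cvg_in_cylinder c x (f : nat -> one_point_compactification R) :
  regular c -> (forall n, (0 < n)%N -> cylinder c n x) ->
  (forall n, (0 < n)%N ->
    \forall t \near \oo, exists2 v, f t = Some v & cylinder c n v) ->
  f t @[t --> \oo] --> (Some x : one_point_compactification R).
Proof.
move=> reg_c xI fI U /nbhs_SomeP[e e0 eU].
have [m m0 me] := two_div_natr_lt e0.
apply: (filterS _ (fI m m0)) => t [v ftv vI] /=; rewrite ftv; apply: eU.
exact: le_lt_trans (cylinder_dist m0 (@regular_clear _ _ reg_c) (xI m m0) vI) me.
Qed.

Lemma errorE c v n : error c v n = v * den c n + error c 0 n.
Proof. by rewrite -[v in RHS]subr0 -errorB subrK. Qed.

Lemma error_continuous c n : continuous (fun v : R => error c v n).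
Proof.
rewrite (funext (fun v => errorE c v n)) => v.
by apply: cvgD; [apply: cvgM; [exact: cvg_id|]|]; exact: cvg_cst.
Qed.

Lemma regular_limit c : regular c ->
  exists x : R, forall n, (0 < n)%N -> cylinder c n x.
Proof.
move=> reg_c.
have /choice[v vI] : forall n, exists v : R, cylinder c n.+1 v.
  move=> n; have [||//|v _ vI] := @head_map_cylinder R c n.+1 None.
  - by [].
  - exact: regular_clear.
  by exists v.
have {}vI m n : (0 < m)%N -> (m <= n.+1)%N -> cylinder c m (v n).
  move=> m0 mn; apply: cylinder_le (vI n); first exact: regular_clear.
  by rewrite m0.
have : cvg (v n @[n --> \oo]).
  apply: cauchy_cvg; suff : cauchy_ex (v n @[n --> \oo]) by exact: cauchy_exP.
  move=> e e0; have [m m0 me] := two_div_natr_lt e0.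
  exists (v m); exists m => // n /= mn; rewrite /ball /=.
  by apply: le_lt_trans (cylinder_dist m0 (@regular_clear _ _ reg_c) _ _) me;
    apply: vI => //; lia.
move=> /cvg_ex[x vx]; exists x => m m0; rewrite /cylinder /=.
have err_cvg k : `|error c (v n) k| @[n --> \oo] --> `|error c x k|.
  apply: cvg_norm; apply: (@cvg_comp _ _ _ v (fun w => error c w k)); first exact: vx.
  exact: error_continuous.
apply: ler_cvg_to (err_cvg _) (err_cvg _) _.
by exists m => // n /= mn; apply: vI => //; exact: leqW.
Qed.

Lemma rational_of_den x (A B : int) : B != 0 -> x * B%:~R = A%:~R -> rational x.
Proof.
move=> B0 xB; exists (A%:~R / B%:~R) => //.
rewrite fmorph_div/= !ratr_int -xB mulfK//.
by rewrite intr_eq0.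
Qed.

(** Up to the sign e^k, the errors from index r on form an arithmetic
    progression with difference d.  They are bounded by 1, so d = 0, which is a
    linear equation for x with integer coefficients. *)
Lemma tail2_rational c x (e : int) r : e * e = 1 -> regular c ->
  (forall n, (0 < n)%N -> cylinder c n x) -> (0 < r)%N ->
  (forall i, c (r + i)%N = 2 * e) -> rational x.
Proof.
move=> ee reg_c xI r0 cr; set E := fun k => error c x (r + k).
set E0 := E 0%N; pose s : R := e%:~R; pose d := E 1%N * s - E0.
have ss : s * s = 1 by rewrite -rmorphM/= ee.
have normX k : `|s ^+ k| = 1.
  rewrite normrX; suff -> : `|s| = 1 by rewrite expr1n.
  by apply/eqP; rewrite -sqrp_eq1// -normrX expr2 ss normr1.
have EE k : E k = s ^+ k * (E0 + k%:R * d).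
  elim/nat_ind2: k => [||k IH1 IH2]; first by rewrite mul0r addr0 mul1r.
    by rewrite expr1 mul1r /d addrC subrK mulrC -mulrA ss mulr1.
  have -> : E k.+2 = 2 * s * E k.+1 - E k.
    by rewrite /E !addnS /error recurSS cr rmorphM.
  rewrite IH1 IH2 !exprS -!natr1.
  apply/eqP; rewrite -subr_eq0; apply/eqP.
  transitivity ((s * s - 1) * s ^+ k * (E0 + k%:R * d)); first by ring.
  by rewrite ss subrr !mul0r.
have bounded k : `|E0 + k.+1%:R * d| <= 1.
  suff : `|E k.+1| <= 1 by rewrite EE normrM normX mul1r.
  rewrite /E addnS.
  by apply: error_le1; [lia|exact: regular_clear|apply: xI; lia].
have d0 : d = 0.
  apply/eqP; rewrite -normr_eq0 eq_le normr_ge0 andbT leNgt; apply/negP => d0.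
  have [m m0] := two_div_natr_lt d0; rewrite ltr_pdivrMr ?ltr0n// ltNge => /negP; apply.
  rewrite mulrC -[m%:R]normr_nat -normrM.
  have -> : m%:R * d = (E0 + m.+1%:R * d) - (E0 + 1%:R * d) by rewrite -natr1; ring.
  exact: le_trans (ler_normB _ _) (lerD (bounded m) (bounded 0%N)).
have eE k : error c x k = x * (recur c 1 0 k : int)%:~R + (recur c 0 1 k : int)%:~R.
  by rewrite errorE !recur_intr.
apply: (@rational_of_den _ (recur c 0 1 r - e * recur c 0 1 r.+1)
  (e * recur c 1 0 r.+1 - recur c 1 0 r)).
  (* The coefficient of x is not 0, as the denominators grow strictly. *)
  rewrite -(intr_eq0 R) rmorphB rmorphM/= !recur_intr subr_eq0; apply/eqP => den_eq.
  have := @den_growth R c r.-1 (@regular_clear _ _ reg_c); rewrite prednK//.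
  rewrite /den -den_eq normrM -[`|e%:~R|]/(`|s ^+ 1|) normX.
  by rewrite mul1r gerDl ler10.
have : E 1%N * s - E0 = 0 by [].
rewrite /E0 /E addn0 addn1 !eE !rmorphB !rmorphM/= -/s => H.
by apply/eqP; rewrite -subr_eq0; apply/eqP; rewrite -[RHS]H; ring.
Qed.

Lemma eventually_constant (u : nat -> nat) :
  (forall n, (0 < n)%N -> (u n.+1 <= u n)%N) ->
  exists2 r, (0 < r)%N & forall n, (r <= n)%N -> u n = u r.
Proof.
move=> u_dec; have ex_val : exists k, `[< exists2 n, (0 < n)%N & u n = k >].
  by exists (u 1%N); apply/asboolP; exists 1%N.
case: (ex_minnP ex_val) => k /asboolP[r r0 urk] mink.
exists r => // n rn; apply/eqP; rewrite eqn_leq; apply/andP; split.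
  elim: n rn => [|n IH]; first by lia.
  rewrite leq_eqVlt => /orP[/eqP<-//|rn]; apply: leq_trans (IH rn).
  by apply: u_dec; lia.
rewrite urk; apply: mink; apply/asboolP; exists n => //.
exact: leq_trans rn.
Qed.

(** For x = A / B the integers u_n = B [error c x n] have nonincreasing modulus,
    eventually a constant, which is not 0 by the Casorati determinant.  If
    u_(n+1) = e u_n with e = 1 or -1, then c_n u_(n+1) = u_(n+2) + u_n with
    u_(n+2) = u_n or - u_n; the latter would give c_n = 0, so c_n = 2 e and
    u_(n+2) = e u_(n+1). *)
Lemma rational_tail2 c x : regular c ->
  (forall n, (0 < n)%N -> cylinder c n x) -> rational x ->
  exists2 e : int, e * e = 1 &
  exists2 r, (0 < r)%N & forall i, c (r + i)%N = 2 * e.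
Proof.
move=> reg_c xI [q _ xq].
have [B [A [B0 xB]]] : exists B A : int, B != 0 /\ x * B%:~R = A%:~R.
  exists (denq q), (numq q); rewrite denq_neq0; split => //.
  rewrite -xq /ratr mulfVK//.
  by rewrite intr_eq0 denq_neq0.
pose u n : int := recur c A B n.
have uE n : (u n)%:~R = B%:~R * error c x n.
  have recur0 : recur c 0 0 n = 0 :> R.
    by elim/nat_ind2: n => // n IH1 IH2; rewrite recurSS IH1 IH2 mulr0 subr0.
  by rewrite recur_intr -xB -[RHS]addr0 -recur0 -recur_lin !addr0 mulr1 mulrC.
have u_dec n : (0 < n)%N -> (`|u n.+1| <= `|u n|)%N.
  move=> n0; rewrite -lez_nat !abszE -(ler_int R) !intr_norm !uE !normrM.
  by rewrite ler_wpM2l// xI.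
have [r r0 u_cst] := eventually_constant u_dec.
have u_neq0 n : (r <= n)%N -> u n != 0.
  move=> rn; apply/eqP => un0; have := recur_casorati c A B 1 0 n.
  rewrite -!/(u _) un0.
  have -> : u n.+1 = 0.
    by apply/eqP; rewrite -absz_eq0 u_cst 1?leqW// -(u_cst _ rn) un0.
  by rewrite !mul0r mulr0 mulr1 subr0 sub0r => /eqP; rewrite eq_sym oppr_eq0 (negbTE B0).
have [e ee ue] : exists2 e : int, e * e = 1 & u r.+1 = e * u r.
  have : (`|u r.+1| == `|u r|)%N by rewrite u_cst.
  rewrite -eqz_nat !abszE eqr_norm2 => /orP[]/eqP ->.
    by exists 1; rewrite ?mul1r.
  by exists (-1); rewrite ?mulN1r.
have step n : (r <= n)%N -> u n.+1 = e * u n ->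
    c n = 2 * e /\ u n.+2 = e * u n.+1.
  move=> rn un; have un0 := u_neq0 n rn.
  have cn : c n != 0.
    by rewrite -absz_eq0 -lt0n; apply: ltnW; apply: reg_c; lia.
  have rec : u n.+2 = c n * u n.+1 - u n by rewrite /u recurSS intz.
  have : (`|u n.+2| == `|u n|)%N by rewrite !u_cst//; lia.
  rewrite -eqz_nat !abszE eqr_norm2 => /orP[]/eqP u2.
    split; last by rewrite u2 un mulrA ee mul1r.
    apply: (mulIf un0); apply/eqP; rewrite -subr_eq0; apply/eqP.
    have -> : c n * u n - 2 * e * u n = e * (c n * u n.+1 - u n - u n)
      + (1 - e * e) * c n * u n by rewrite un; ring.
    by rewrite -rec u2 ee; ring.
  exfalso; move/eqP: cn; apply; apply: (mulIf un0); rewrite mul0r.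
  have -> : c n * u n = e * (c n * u n.+1 - u n + u n) + (1 - e * e) * c n * u n.
    by rewrite un; ring.
  by rewrite -rec u2 ee; ring.
exists e => //; exists r => // i.
suff [] : u (r + i).+1 = e * u (r + i)%N /\ c (r + i)%N = 2 * e by [].
elim: i => [|i [IH _]]; first by rewrite addn0; have [] := step r (leqnn r) ue.
by rewrite addnS; have [_ IH2] := step _ (leq_addr _ _) IH;
  have [] := step (r + i).+1 (leqW (leq_addr _ _)) IH2.
Qed.

End RegularLimit.

(** * Positions of the contractions and convergence *)

Section Positions.
Context {R : realType}.
Implicit Types (b c : nat -> int).

Lemma pos_clear b n K : (K%:R%:E < pos R b n)%E <-> clear_upto K (Phi_iter n b).
Proof.
split=> [Kpos|/clear_uptoP clearK].
  apply/clear_uptoP => m bm; move: Kpos; rewrite /pos bm.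
  by rewrite lte_fin ltr_nat.
rewrite /pos; case bm: first_small => [m|]; last exact: ltry.
by rewrite lte_fin ltr_nat clearK.
Qed.

Lemma pos_to_infty_clear b K : pos_to_infty R b ->
  exists T, forall s, (T <= s)%N -> clear_upto K (Phi_iter s b).
Proof.
move=> /cvgeyPgt/(_ K%:R)[T _ posT]; exists T => s Ts.
by apply/pos_clear; exact: posT.
Qed.

Lemma liminf_pos_clear b (P := (liminf_pos R b).-1) : ~ pos_to_infty R b ->
  (exists T, forall s, (T <= s)%N -> clear_upto P (Phi_iter s b)) /\
  (forall N, exists2 s, (N <= s)%N & first_small (Phi_iter s b) = Some P.+1).
Proof.
move=> /liminf_posP[p0 pE].
have supE : ereal_sup (range (einfs (pos R b))) = P.+1%:R%:E.
  rewrite /P prednK// -pE limn_einf_lim; apply/esym/cvg_lim => //.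
  exact: cvg_einfs_sup.
have [T clearT] : exists T, forall s, (T <= s)%N -> clear_upto P (Phi_iter s b).
  have : (P%:R%:E < ereal_sup (range (einfs (pos R b))))%E.
    by rewrite supE lte_fin ltr_nat.
  move=> /ereal_sup_gt[_ [T _ <-] PT]; exists T => s Ts; apply/pos_clear.
  by apply: lt_le_trans PT _; apply: ereal_inf_lbound; exists s.
split; first by exists T.
move=> N; have : (einfs (pos R b) (maxn N T) < P.+2%:R%:E)%E.
  apply: (@le_lt_trans _ _ P.+1%:R%:E); last by rewrite lte_fin ltr_nat.
  by rewrite -supE; apply: ereal_sup_ubound; exists (maxn N T).
move=> /ereal_inf_lt[_ [s /= Ns <-]]; rewrite /pos.
have [Ns' Ts] : (N <= s)%N /\ (T <= s)%N by lia.
case bm: first_small => [m|//]; rewrite lte_fin ltr_nat => mP.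
exists s => //; rewrite bm; congr Some.
by have := (clear_uptoP P _).1 (clearT s Ts) m bm; lia.
Qed.

Lemma limit_cf_prefix b K T : pos_to_infty R b ->
  (forall s, (T <= s)%N -> clear_upto K (Phi_iter s b)) ->
  forall s j, (T <= s)%N -> (j < K)%N -> Phi_iter s b j = limit_cf b j.
Proof.
move=> b_oo clearK s j Ts jK; have [N _ limN] := limit_cfP b_oo j.
rewrite (Phi_iter_lt clearK Ts jK) -(limN (maxn N T)) /=; last exact: leq_maxl.
by rewrite (Phi_iter_lt clearK)// leq_maxr.
Qed.

Lemma regular_limit_cf b : pos_to_infty R b -> regular (limit_cf b).
Proof.
move=> b_oo k k0; have [T clearT] := pos_to_infty_clear k.+1 b_oo.
rewrite -(limit_cf_prefix b_oo clearT (leqnn T))//.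
by apply: clearT => //; lia.
Qed.

Lemma convergents_cylinder b n : pos_to_infty R b -> (0 < n)%N ->
  \forall t \near \oo, exists2 v : R, convergent R b t = Some v &
    cylinder (limit_cf b) n v.
Proof.
move=> b_oo n0; have [T clearT] := pos_to_infty_clear n.+1 b_oo.
have [N convN] := @convergent_clear_from R _ _ _ clearT.
exists N => // t /= /convN[s [i [Ts ni clear_i ->]]].
have [||z z_far ->] := @convergent_far R (Phi_iter s b) n i.
- by lia.
- by move=> j jn; apply: clear_i; lia.
rewrite (@eq_head_map _ _ (limit_cf b)); last first.
  by move=> j jn; apply: (limit_cf_prefix b_oo clearT Ts); lia.
have [||v vE vI] := @head_map_cylinder R (limit_cf b) n z n0.
- exact/regular_clear/regular_limit_cf.
- apply: far_le z_far; rewrite lerBrDr -[leLHS]/2 ler_nat.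
  by apply: clear_i; lia.
by exists v.
Qed.

Lemma convergents_cvg b : pos_to_infty R b -> exists2 x : R,
  (forall n, (0 < n)%N -> cylinder (limit_cf b) n x) & converges_to b (Some x).
Proof.
move=> b_oo; have reg := regular_limit_cf b_oo.
have [x xI] := @regular_limit R _ reg; exists x => //.
apply: (cvg_in_cylinder reg xI) => n n0; exact: convergents_cylinder.
Qed.

Lemma ext_rational_head c n (z : one_point_compactification R) :
  ext_rational z -> ext_rational (head_map c n z).
Proof.
elim: n z => //= n IH z z_rat; apply: IH; case: z z_rat => [x|_] /=.
  case: eqP => //= _ /rationalP[a [k ->]].
  exists ((c n)%:~R - (a%:~R / k%:R)^-1) => //.
  by rewrite rmorphB/= fmorphV fmorph_div/= !ratr_int ratr_nat.
by exists (c n)%:~R; rewrite ?ratr_int.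
Qed.

Lemma head_map_cvg_infty c n (f : nat -> one_point_compactification R) :
  (forall r, \forall t \near \oo, exists2 z, far r z & f t = head_map c n z) ->
  f t @[t --> \oo] --> head_map c n None.
Proof.
move=> f_far U /(@head_map_continuous R c n None)/nbhs_inftyP[r rU].
by apply: filterS (f_far r) => t [z z_far] /= ->; exact: rU.
Qed.

(** The coefficients before position P freeze; the modulus of the coefficient at
    P, minus 1, bounds from below the modulus of the argument that the frozen
    map takes to a late convergent. *)
Lemma unbounded_convergents b (P := (liminf_pos R b).-1) : ~ pos_to_infty R b ->
  modulus_before R b n @[n --> \oo] --> \oo ->
  exists c, converges_to b (head_map c P (None : one_point_compactification R)).
Proof.
move=> /liminf_pos_clear[[T clearT] _] /cvgnyPge q_oo.
exists (Phi_iter T b); apply: head_map_cvg_infty => r.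
have [T' _ qT'] := q_oo (Num.bound `|r|).+1.
have clearT' s : (maxn T T' <= s)%N -> clear_upto P (Phi_iter s b).
  by move=> Ts; apply: clearT; lia.
have [N convN] := @convergent_clear_from R _ _ _ clearT'.
exists N => // t /= /convN[s [i [Ts Pi clear_i ->]]].
have [||z z_far ->] := @convergent_far R (Phi_iter s b) P i.
- by [].
- by move=> j jn; apply: clear_i; lia.
exists z; last first.
  by apply: eq_head_map => j jP; apply: (Phi_iter_lt clearT) => //; lia.
apply: far_le z_far; rewrite lerBrDr.
have : (Num.bound `|r|).+1%:R <= `|Phi_iter s b P|%N%:R :> R.
  by rewrite ler_nat; apply: qT' => /=; lia.
apply: le_trans; rewrite -natr1 lerD2r; apply: le_trans (ler_norm r) _.
by apply/ltW/archi_boundP.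
Qed.

(** In the coordinate y = U^(-1)(v), with U the frozen head, each late
    coefficient c_P of the iterates is the coordinate of arbitrarily late
    convergents ([visit]).  If y converged to infinity, the moduli would tend to
    infinity; if y converged to a real r, then all late c_P would be within 1/2
    of r and no late y would be infinite, while a contraction at P + 1 either
    changes c_P by 1 or exhibits y = infinity. *)
Lemma bounded_diverges b : ~ pos_to_infty R b ->
  ~ (modulus_before R b n @[n --> \oo] --> \oo) -> diverges R b.
Proof.
move=> b_oo q_oo [l vl]; set P := (liminf_pos R b).-1.
have [[T clearT] hits] := liminf_pos_clear b_oo; rewrite -/P in clearT hits.
pose y t := head_inv (Phi_iter T b) P (convergent R b t).
have yE s z t : (T <= s)%N -> convergent R b t = head_map (Phi_iter s b) P z ->
    y t = z.
  move=> Ts tz; rewrite /y tz.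
  rewrite (@eq_head_map _ _ (Phi_iter T b)) ?head_mapK// => j jP.
  exact: (Phi_iter_lt clearT).
(* At a contraction at P + 1 the new coefficient at P is the coordinate of a
   surviving convergent; if the removed coefficient is 0, the convergent of
   index P + 1 has coordinate infinity. *)
have hit_visit s : (T <= s)%N -> first_small (Phi_iter s b) = Some P.+1 ->
    (exists2 t, (s <= t)%N & y t = Some (Phi_iter s.+1 b P)%:~R) /\
    (Phi_iter s b P.+1 = 0 -> exists2 t, (s <= t)%N & y t = None).
  move=> Ts hit; have [N [d [convE /(_ _ hit)[NP sd]]]] := @convergent_Phi_iter R b s.
  have size0 := contract_size_gt0 (Phi_iter s b P.+1); split=> [|b0].
    exists (P + contract_size (Phi_iter s b P.+1) + d)%N; first by lia.
    apply: (@yE s.+1); first exact: leqW.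
    rewrite -convE; last by lia.
    by rewrite -(convergent_Phi hit)//= convergentE.
  exists (P.+1 + d)%N; first by lia.
  by apply: (@yE s) => //; rewrite -convE// convergentE /= b0 eqxx.
(* Between contractions at P + 1 the coefficient at P does not change, so the
   convergent found at the last of them still witnesses it. *)
have visit N : exists s0, forall s, (s0 <= s)%N ->
    exists2 t, (N <= t)%N & y t = Some (Phi_iter s b P)%:~R.
  have [s1 s1N hit1] := hits (maxn N T).
  exists s1.+1; elim=> // s IH; rewrite ltnS => s1s.
  have [Ts Ns] : (T <= s)%N /\ (N <= s)%N by lia.
  have [hit|no_hit] := pselect (first_small (Phi_iter s b) = Some P.+1).
    have [[t st yt] _] := hit_visit s Ts hit.
    by exists t => //; exact: leq_trans st.
  have {}IH : (s1 < s)%N -> exists2 t, (N <= t)%N &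
    y t = Some (Phi_iter s b P)%:~R by exact: IH.
  have s1s' : (s1 < s)%N.
    by rewrite ltn_neqAle s1s andbT; apply: contra_notN no_hit => /eqP <-.
  have -> : Phi_iter s.+1 b P = Phi_iter s b P; last exact: IH.
  rewrite /Phi_iter iterS; apply: (@Phi_lt P.+1) => //.
  apply/clear_uptoP => m bm; rewrite ltn_neqAle; apply/andP; split.
    by apply: contra_notN no_hit => /eqP ->.
  exact: (clear_uptoP P _).1 (clearT s Ts) m bm.
have : y t @[t --> \oo] --> head_inv (Phi_iter T b) P l.
  by apply: cvg_comp vl _; exact: head_inv_continuous.
case: (head_inv _ _ l) => [r|] y_cvg.
  pose U : set (one_point_compactification R) :=
    fun z => if z is Some a then `|r - a| < 2^-1 else false.
  have [N _ yN] : \forall t \near \oo, U (y t).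
    by apply: (y_cvg U); apply/nbhs_SomeP; exists 2^-1.
  have [s0 visit0] := visit N.
  have [s sN hit] := hits (maxn s0 (maxn N T)).
  have [[t st yt] hit0] := hit_visit s ltac:(lia) hit.
  have [b0|b0] := eqVneq (Phi_iter s b P.+1) 0.
    have [t' st' yt'] := hit0 b0; have := yN t' ltac:(rewrite /=; lia).
    by rewrite /U /= yt'.
  have [t' Nt' yt'] := visit0 s ltac:(lia).
  have := yN t' Nt'; have := yN t ltac:(rewrite /=; lia); rewrite /U /= yt yt'.
  rewrite /Phi_iter iterS -/(Phi_iter s b) (Phi_before_unit hit b0) => d1 d2.
  have : `|(Phi_iter s b P.+1)%:~R| < 1 :> R.
    have -> : (Phi_iter s b P.+1)%:~R
      = (r - (Phi_iter s b P - Phi_iter s b P.+1)%:~R)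
        - (r - (Phi_iter s b P)%:~R) :> R by rewrite rmorphB/=; ring.
    by apply: le_lt_trans (ler_normB _ _) _; lra.
  by rewrite -intr_norm -[1]/(1%:~R) ltr_int; lia.
apply: q_oo; apply/cvgnyPge => A; apply: contrapT => qA.
have [N _ yN] := y_cvg _ (far_nbhs_infty A%:R).
have [s0 visit0] := visit N.
apply: qA; exists s0 => // s /= /visit0[t Nt yt].
have := yN t Nt; rewrite /= yt /= -intr_norm -abszE => h.
by rewrite /modulus_before -(ler_nat R) -/P.
Qed.

End Positions.

Theorem theorem1p1 (R : realType) (b : nat -> int) :
  (pos_to_infty R b ->
     let tail2 := same_tail (limit_cf b) (fun=> 2)
               \/ same_tail (limit_cf b) (fun=> -2) in
     (tail2 -> exists2 x : R, rational x & converges_to b (Some x)) /\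
     (~ tail2 -> exists2 x : R, irrational x & converges_to b (Some x))) /\
  (~ pos_to_infty R b ->
     let q := modulus_before R b in
     (q n @[n --> \oo] --> \oo ->
        exists2 x : one_point_compactification R,
          ext_rational x & converges_to b x) /\
     (~ (q n @[n --> \oo] --> \oo) -> diverges R b)).
Proof.
split=> [b_oo tail2|b_oo q].
  have reg := regular_limit_cf b_oo.
  have [x xI bx] := convergents_cvg b_oo; split=> [b2|not_b2]; exists x => //.
    have [e ee [r r0 re]] : exists2 e : int, e * e = 1 &
        exists2 r, (0 < r)%N & forall i, limit_cf b (r + i)%N = 2 * e.
      case: b2 => -[r [s [r0 _ re]]]; [exists 1 => //|exists (-1) => //];
      by exists r => // i; rewrite re.
    exact: (tail2_rational ee reg xI r0 re).
  move=> /(rational_tail2 reg xI)[e ee [r r0 re]]; apply: not_b2.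
  have [e1|e1] : e = 1 \/ e = -1 by nia.
    by left; exists r, r; split=> // i; rewrite re e1.
  by right; exists r, r; split=> // i; rewrite re e1.
split=> [q_oo|]; last exact: bounded_diverges.
have [c bc] := unbounded_convergents b_oo q_oo.
by eexists; [|exact: bc]; exact: ext_rational_head.
Qed.
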